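(* Let $C$ be a fixed membership set of $m$ scalar records with values $\bm x_C=(x_k)_{k\in C}\in\mathbb{R}^m$ that are pairwise distinct, and let $y_\ell=q_\ell(\bm x_C)+w_\ell$, $\ell=1,\dots,L$, be releases with Gaussian noise $\bm w=(w_1,\dots,w_L)\sim\mathcal N(\bm 0,\bm\Sigma)$, $\bm\Sigma\succ\bm 0$ not depending on $\bm x_C$, such that each $q_\ell$ is permutation-invariant: $q_\ell(\bm x_C)=q_\ell(\pi\bm x_C)$ for every $\pi\in\mathfrak S_m$. Let $z=\bm x_C^{\uparrow}\in\mathcal W=\{u\in\mathbb{R}^m:u_1<\cdots<u_m\}$ be the sorted representative. On any neighborhood of $\bm x_C$ that does not intersect a collision hyperplane, the following hold. (i) The joint observation law is permutation-invariant, $p(\bm y\mid\bm x_C)=p(\bm y\mid\pi\bm x_C)$ for all $\pi\in\mathfrak S_m$, so the labeled vector $\bm x_C$ is not globally identifiable from $(y_1,\dots,y_L)$. (ii) The quotient by permutations admits a local chart given by the sorted representative $z$. (iii) The unlabeled matching loss $\min_{\pi\in\mathfrak S_m}\|\hat{\bm x}_C-\pi(\bm x_C)\|_2^2$ coincides locally with the squared error in sorted coordinates $\|\hat z-z\|_2^2$, where $\hat z=\hat{\bm x}_C^{\uparrow}$.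
   Context: $\mathfrak S_m$ is the symmetric group acting on $\mathbb{R}^m$ by permuting coordinates. For $u\in\mathbb{R}^m$, $u^{\uparrow}$ is the vector of its entries sorted in increasing order. The collision hyperplanes are $\{u\in\mathbb{R}^m:u_a=u_b\}$, $a\ne b$. $p(\bm y\mid\bm x_C)$ is the density of $\bm y=(y_1,\dots,y_L)$. The quotient in (ii) is the orbit space of $\mathfrak S_m$ acting on vectors with pairwise distinct entries; (ii) says that sorting induces a local coordinate system on it with values in $\mathcal W$. Non-identifiability in (i) is understood for $m\ge2$. *)

(* Defs.v *)
From HB Require Import structures.
From mathcomp Require Import all_boot all_order all_algebra all_fingroup.
From mathcomp Require Import all_classical all_reals all_analysis.
Set Implicit Arguments.
Unset Strict Implicit.
Unset Printing Implicit Defensive.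
Import Order.TTheory GRing.Theory Num.Theory numFieldNormedType.Exports.
Local Open Scope classical_set_scope.
Local Open Scope ring_scope.

Section vectors.
Context {R : realType} {m : nat}.
Implicit Types (u v : 'rV[R]_m) (s : 'S_m).

Definition collision_hyperplane (a b : 'I_m) : set 'rV[R]_m :=
  [set u | u 0 a = u 0 b].

Definition distinct_vectors : set 'rV[R]_m := [set u | injective (u 0)].

Definition sorted_up u : 'rV[R]_m :=
  \row_i nth 0 (sort <=%R [seq u 0 j | j <- enum 'I_m]) i.

Definition weyl_chamber : set 'rV[R]_m :=
  [set u | forall i j : 'I_m, (i < j)%N -> u 0 i < u 0 j].

(* The library norm of a row vector is the sup norm, hence this one. *)
Definition sqnorm2 u : R := \sum_i (u 0 i) ^+ 2.

(* The minimum over all of 'S_m; the default value is the term at s = 1, so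
   it does not affect the minimum. *)
Definition matching_loss (xhat x : 'rV[R]_m) : R :=
  \big[Order.min/sqnorm2 (xhat - col_perm 1%g x)]_(s : 'S_m)
     sqnorm2 (xhat - col_perm s x).

End vectors.

(* Topologized as a subspace of 'rV[R]_m. *)
Definition config (R : realType) (m : nat) : Type :=
  set_type (@distinct_vectors R m).
HB.instance Definition _ (R : realType) (m : nat) := Topological.on (config R m).

Section orbits.
Context {R : realType} {m : nat}.

Definition same_orbit (u v : config R m) : bool :=
  [exists s : 'S_m, set_val v == col_perm s (set_val u)].

Lemma same_orbit_refl : reflexive same_orbit.
Proof. by move=> u; apply/existsP; exists 1%g; rewrite col_perm1. Qed.

Lemma same_orbit_sym : symmetric same_orbit.
Proof.
suff H u v : same_orbit u v -> same_orbit v u.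
  by move=> u v; apply/idP/idP; apply: H.
move=> /existsP[s /eqP vE]; apply/existsP; exists s^-1%g.
by rewrite vE -col_permM mulVg col_perm1.
Qed.

Lemma same_orbit_trans : transitive same_orbit.
Proof.
move=> v u w /existsP[s /eqP vE] /existsP[t /eqP wE]; apply/existsP.
by exists (t * s)%g; rewrite wE vE -col_permM.
Qed.

Canonical same_orbit_equiv :=
  EquivRel same_orbit same_orbit_refl same_orbit_sym same_orbit_trans.

End orbits.

(* Distinct vectors modulo 'S_m, with the quotient topology. *)
Definition orbit_space (R : realType) (m : nat) : Type :=
  quotient_topology {eq_quot @same_orbit R m}%qT.
HB.instance Definition _ (R : realType) (m : nat) :=
  Topological.on (orbit_space R m).
HB.instance Definition _ (R : realType) (m : nat) :=
  Quotient.on (orbit_space R m).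

Definition orbit_proj {R : realType} {m : nat} (u : config R m) :
  orbit_space R m := (\pi_(orbit_space R m) u)%qT.

(* Uses an arbitrary representative of the orbit o. *)
Definition sort_orbit {R : realType} {m : nat} (o : orbit_space R m) :
  'rV[R]_m := sorted_up (set_val (generic_quotient.repr o)).

Section charts.

Definition topological_chart {R : realType} {m : nat} {X : topologicalType}
    (D : set X) (f : X -> 'rV[R]_m) : Prop :=
  [/\ open D, open (f @` D), (forall x, D x -> {for x, continuous f}) &
      exists g : 'rV[R]_m -> X,
        (forall x, D x -> g (f x) = x) /\
        (forall z, (f @` D) z -> {for z, continuous g})].

Fixpoint iter_derive {R : realType} {V W : normedModType R} (f : V -> W)
    (vs : seq V) : V -> W :=
  if vs is v :: vs' then fun x => 'D_v (iter_derive f vs') x else f.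

(* C^infinity on an open set: all iterated directional derivatives are
   differentiable there. *)
Definition smooth_on {R : realType} {V W : normedModType R} (D : set V)
    (f : V -> W) : Prop :=
  forall vs x, D x -> differentiable (iter_derive f vs) x.

Definition local_diffeo_at {R : realType} {V W : normedModType R}
    (f : V -> W) (x : V) : Prop :=
  exists (N : set V) (g : W -> V),
    [/\ open N /\ N x, open (f @` N), smooth_on N f, smooth_on (f @` N) g &
        forall u, N u -> g (f u) = u].

End charts.

Section observations.
Context {R : realType}.

(* Lebesgue integral over R^n of a nonnegative measurable function, as an
   iterated integral (Tonelli). *)
Fixpoint integral_tuple (n : nat) : (n.-tuple R -> \bar R) -> \bar R :=
  match n with
  | 0 => fun f => f [tuple]
  | n'.+1 => fun f =>
      (\int[@lebesgue_measure R]_t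
         integral_tuple (fun y : n'.-tuple R => f [tuple of t :: y]))%E
  end.

Definition has_density (n : nat) (mu : set (n.-tuple R) -> \bar R)
    (f : n.-tuple R -> R) : Prop :=
  forall A : set (n.-tuple R), measurable A ->
    mu A = integral_tuple (fun y => (f y * \1_A y)%:E).

Definition positive_definite (n : nat) (S : 'M[R]_n) : Prop :=
  S^T = S /\ forall v : 'rV[R]_n, v != 0 -> 0 < (v *m S *m v^T) 0 0.

Definition gaussian_pdf (n : nat) (mu : 'rV[R]_n) (S : 'M[R]_n)
    (y : n.-tuple R) : R :=
  let r := \row_i tnth y i - mu in
  (Num.sqrt ((2 * pi) ^+ n * \det S))^-1 *
    expR (- (r *m invmx S *m r^T) 0 0 / 2).

Definition is_gaussian (n : nat) (law : set (n.-tuple R) -> \bar R)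
    (mu : 'rV[R]_n) (S : 'M[R]_n) : Prop :=
  has_density law (gaussian_pdf mu S).

Definition permutation_invariant (m : nat) (f : 'rV[R]_m -> R) : Prop :=
  forall (s : 'S_m) (u : 'rV[R]_m), f u = f (col_perm s u).

Definition release (T : Type) (m L : nat) (q : 'I_L -> 'rV[R]_m -> R)
    (w : T -> L.-tuple R) (x : 'rV[R]_m) : T -> L.-tuple R :=
  fun t => [tuple q l x + tnth (w t) l | l < L].

Definition release_density (m L : nat) (q : 'I_L -> 'rV[R]_m -> R)
    (S : 'M[R]_L) (y : L.-tuple R) (x : 'rV[R]_m) : R :=
  gaussian_pdf (\row_l q l x) S y.

Definition same_law (d : measure_display) (T : measurableType d)
    (mu nu : set T -> \bar R) : Prop :=
  forall A, measurable A -> mu A = nu A.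

Definition globally_identifiable_at (P : Type) (d : measure_display)
    (T : measurableType d) (law : P -> set T -> \bar R) (x : P) : Prop :=
  forall x', same_law (law x') (law x) -> x' = x.

End observations.

(* Main.v *)
Require Import Defs.
From HB Require Import structures.
From mathcomp Require Import all_boot all_order all_algebra all_fingroup.
From mathcomp Require Import all_classical all_reals all_analysis.
From mathcomp Require Import measurable_realfun.
Set Implicit Arguments.
Unset Strict Implicit.
Unset Printing Implicit Defensive.
Import Order.TTheory GRing.Theory Num.Theory numFieldNormedType.Exports.
Local Open Scope classical_set_scope.
Local Open Scope ring_scope.

(* Around a vector u with pairwise distinct entries, the permutation that sorts
   u also sorts every nearby vector, because the Weyl chamber is open.  Sorting
   is therefore locally a coordinate permutation, hence smooth with smooth
   inverse, and it descends to a homeomorphism from the orbit space onto its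
   image.  The matching loss is handled by the rearrangement inequality: among
   all pairings of two vectors the sorted one minimizes the squared distance.
   The Gaussian law of a release is a translate of the law of the noise, and
   the translation vector is permutation-invariant. *)

(** * Sorting as a coordinate permutation *)

Section sorting.
Context {R : realType} {m : nat}.
Implicit Types (u v : 'rV[R]_m) (s : 'S_m).

Let entries u := [seq u 0 j | j <- enum 'I_m].

Lemma size_entries u : size (entries u) = m.
Proof. by rewrite size_map size_enum_ord. Qed.

Lemma sorted_up_col_perm u s : sorted_up (col_perm s u) = sorted_up u.
Proof.
apply/rowP => i; rewrite !mxE; congr nth.
have -> : [seq col_perm s u 0 j | j <- enum 'I_m]
    = [seq u 0 j | j <- [seq s j | j <- enum 'I_m]].
  by rewrite -[RHS]map_comp; apply: eq_map => j; rewrite /= mxE.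
apply/perm_sort_leP; apply: perm_map.
apply: uniq_perm; rewrite ?enum_uniq ?(map_inj_uniq perm_inj) ?enum_uniq//.
move=> j; rewrite mem_enum; apply/mapP; exists (s^-1%g j); rewrite ?mem_enum//.
by rewrite permKV.
Qed.

Lemma sorted_up_mono u (i j : 'I_m) : (i <= j)%N ->
  sorted_up u 0 i <= sorted_up u 0 j.
Proof.
move=> ij; rewrite !mxE.
apply: (sorted_leq_nth le_trans le_refl) => //.
- exact: sort_le_sorted.
- by rewrite inE size_sort size_entries.
- by rewrite inE size_sort size_entries.
Qed.

(** Reduces sorting to the action of ['S_m]; the permutation [s] depends on [u]. *)
Lemma sorted_upE u : exists s, sorted_up u = col_perm s u.
Proof.
have sz : size (sort <=%R (entries u)) == m by rewrite size_sort size_entries.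
have : perm_eq (Tuple sz) [tuple u 0 j | j < m].
  by rewrite /= perm_sort.
move=> /tuple_permP[s sE]; exists s; apply/rowP => i; rewrite !mxE.
rewrite [X in nth _ X _]sE (nth_map i) ?size_enum_ord//.
by rewrite tnth_mktuple nth_ord_enum.
Qed.

Lemma sorted_up_weyl u : weyl_chamber u -> sorted_up u = u.
Proof.
have entriesE (i : 'I_m) : nth 0 (entries u) i = u 0 i.
  by rewrite (nth_map i) ?size_enum_ord// nth_ord_enum.
move=> wu; apply/rowP => i; rewrite mxE sort_le_id; first exact: entriesE.
apply/(sortedP 0) => k; rewrite size_entries => km.
have /ltW := wu (Ordinal (ltnW km)) (Ordinal km) (ltnSn k).
by rewrite -!entriesE.
Qed.

Lemma col_perm_distinct u s :
  distinct_vectors u -> distinct_vectors (col_perm s u).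
Proof. by move=> du i j; rewrite !mxE => /du/perm_inj. Qed.

Lemma weyl_distinct u : weyl_chamber u -> distinct_vectors u.
Proof.
move=> wu i j uij; case: (ltngtP i j) => [/wu|/wu|/val_inj//];
  by rewrite uij ltxx.
Qed.

Lemma sorted_up_in_weyl u : distinct_vectors u -> weyl_chamber (sorted_up u).
Proof.
move=> du i j ij; rewrite lt_neqAle sorted_up_mono ?(ltnW ij)// andbT.
have [s ->] := sorted_upE u.
by apply: contraTneq ij => /(col_perm_distinct du)->; rewrite ltnn.
Qed.

Lemma col_perm_nontrivial u : (1 < m)%N -> distinct_vectors u ->
  exists s, col_perm s u != u.
Proof.
move=> m1 du; pose i := Ordinal (ltnW m1); pose j := Ordinal m1.
exists (tperm i j); apply/eqP => /rowP/(_ i).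
by rewrite mxE tpermL => /du.
Qed.

End sorting.

(** * The rearrangement inequality *)

Section rearrangement.
Context {R : realType} {m : nat}.
Implicit Types (a b : 'I_m -> R) (s : 'S_m).

(* A monotone correspondence is cyclically monotone: [phi] plays the part of a
   convex function with subgradient [a i] at [b i], so that the sum over a
   permutation telescopes. *)
Lemma monotone_potential a b :
  {homo a : i j / (i <= j)%N >-> i <= j} ->
  {homo b : i j / (i <= j)%N >-> i <= j} ->
  exists phi : 'I_m -> R, forall i j, a i * (b j - b i) <= phi j - phi i.
Proof.
move=> ha hb.
(* Indices move to [nat] so that interval sums apply. The default 0 is never met, since every index
   used is below [m]. *)
pose ext (f : 'I_m -> R) k := if insub k is Some o then f o else 0.
have extE f (i : 'I_m) : ext f i = f i by rewrite /ext valK.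
pose A := ext a; pose B := ext b.
have hA k l : (k <= l < m)%N -> A k <= A l.
  case/andP=> kl lm; have km := leq_ltn_trans kl lm.
  by have := ha (Ordinal km) (Ordinal lm) kl; rewrite -!extE.
have hB k : (k.+1 < m)%N -> 0 <= B k.+1 - B k.
  move=> km; rewrite subr_ge0.
  by have := hb (Ordinal (ltnW km)) (Ordinal km) (leqnSn k); rewrite -!extE.
(* A left-endpoint Stieltjes sum of [a] against [b]. Between [i] and [j] the weights [A k] are at
   least [A i] if [i <= j] and at most [A i] if [j < i], which gives the bound in both cases. *)
pose F n := \sum_(0 <= k < n) A k * (B k.+1 - B k).
exists (fun i => F i) => i j; rewrite -!extE -/A -/B.
have [ij|/ltnW ji] := leqP i j.
  rewrite /F (@big_cat_nat _ _ _ i 0%N j)//= [X in _ <= X]addrAC subrr add0r.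
  rewrite -telescope_sumr// mulr_sumr !big_nat.
  apply: ler_sum => k /andP[ik kj].
  apply: ler_wpM2r; first by apply: hB; apply: leq_ltn_trans (ltn_ord j).
  by apply: hA; rewrite ik (ltn_trans kj).
rewrite /F (@big_cat_nat _ _ _ j 0%N i)//= opprD addNKr.
rewrite -[B j - _]opprB mulrN lerN2.
rewrite -telescope_sumr// mulr_sumr !big_nat; apply: ler_sum => k /andP[jk ki].
apply: ler_wpM2r; first by apply: hB; apply: leq_ltn_trans (ltn_ord i).
by apply: hA; rewrite (ltnW ki) ltn_ord.
Qed.

(** Summing the potential inequality over the pairs [(i, s i)] leaves differences of [phi] whose
    total vanishes, as [s] permutes the indices. *)
Lemma rearrangement a b s :
  {homo a : i j / (i <= j)%N >-> i <= j} ->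
  {homo b : i j / (i <= j)%N >-> i <= j} ->
  \sum_i a i * b (s i) <= \sum_i a i * b i.
Proof.
move=> ha hb; have [phi phiP] := monotone_potential ha hb.
rewrite -subr_le0 -sumrB.
apply: le_trans (_ : \sum_i (phi (s i) - phi i) <= _).
  by apply: ler_sum => i _; rewrite -mulrBr.
by rewrite sumrB [X in _ - X](reindex_inj (@perm_inj _ s)) subrr.
Qed.

End rearrangement.

(** * The matching loss in sorted coordinates *)

Section matching.
Context {R : realType} {m : nat}.
Implicit Types (u v : 'rV[R]_m) (s : 'S_m).

Lemma sqnorm2_col_perm u s : sqnorm2 (col_perm s u) = sqnorm2 u.
Proof.
rewrite /sqnorm2 [RHS](reindex_inj (@perm_inj _ s)) /=.
by apply: eq_bigr => i _; rewrite mxE.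
Qed.

Lemma sqnorm2B_col_perm u v s :
  sqnorm2 (col_perm s u - v) = sqnorm2 (u - col_perm s^-1%g v).
Proof.
by rewrite -(sqnorm2_col_perm (u - _) s) linearB/= -col_permM mulgV col_perm1.
Qed.

(** Once the squares are expanded, the two norms do not depend on [s]; the rearrangement inequality
    bounds the remaining cross term. *)
Lemma sqnorm2_sorted_le u v s :
  sqnorm2 (sorted_up u - sorted_up v) <=
  sqnorm2 (sorted_up u - col_perm s (sorted_up v)).
Proof.
set a := sorted_up u; set b := sorted_up v.
have sqE w : sqnorm2 (a - w) =
    sqnorm2 a + sqnorm2 w - (\sum_i a 0 i * w 0 i) *+ 2.
  rewrite /sqnorm2 -sumrMnl -big_split -sumrB /=; apply: eq_bigr => i _.
  by rewrite !mxE sqrrB addrAC.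
rewrite !sqE sqnorm2_col_perm lerD2l lerN2 lerMn2r /=.
have bE i : col_perm s b 0 i = b 0 (s i) by rewrite mxE.
under eq_bigr do rewrite bE.
by apply: (@rearrangement _ _ (a 0) (b 0)) => i j; apply: sorted_up_mono.
Qed.

Lemma matching_loss_sorted u v :
  matching_loss u v = sqnorm2 (sorted_up u - sorted_up v).
Proof.
have [t tE] := sorted_upE u; have [r rE] := sorted_upE v.
(* Sorting [u] by [t] and [v] by [r] turns [s] into [t * s * r^-1], so that [s = t^-1 * r] yields
   the sorted pairing. *)
have lossE s : sqnorm2 (u - col_perm s v) =
    sqnorm2 (sorted_up u - col_perm (t * s * r^-1)%g (sorted_up v)).
  rewrite tE sqnorm2B_col_perm rE -!col_permM.
  congr (sqnorm2 (_ - col_perm _ _)).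
  by rewrite !mulgA mulVg mul1g mulgKV.
apply/le_anti/andP; split.
  apply: le_trans (bigmin_le _ (t^-1 * r)%g _) _ => //.
  by rewrite lossE mulgA mulgV mul1g mulgV col_perm1.
by apply: le_bigmin => *; rewrite lossE; apply: sqnorm2_sorted_le.
Qed.

End matching.

(** * Smoothness on open sets *)

Section smoothness.
Context {R : realType} {V W : normedModType R}.
Implicit Types (f g : V -> W) (D : set V).

(** The first-order expansion of [g] at [x] is also one for [f], and uniqueness of the differential
    identifies ['d f x] with ['d g x]. *)
Lemma near_eq_differentiable f g x :
  {near x, f =1 g} -> differentiable g x -> differentiable f x.
Proof.
move=> fg dg.
have fgx : f x = g x := nbhs_singleton fg.
have gE := diff_locally dg.
have fE : f \o shift x = cst (f x) + 'd g x +o_ 0 id.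
  apply/eqaddoP => e e0.
  move/eqaddoP: gE => /(_ e e0).
  have fg0 : \forall h \near (0 : V), f (h + x) = g (h + x).
    by move: fg; rewrite (near_shift 0) subr0.
  apply: filterS2 fg0 => h fgh /=.
  by rewrite !fctE /= fgh fgx.
have dgc : continuous ('d g x) by exact: diff_continuous.
have dfE := diff_unique dgc fE.
by apply/diff_locallyP; rewrite dfE.
Qed.

(** A directional derivative depends only on the germ at the point, so equality on an open set
    passes to all iterated derivatives. *)
Lemma smooth_on_eq D f g : open D -> {in D, f =1 g} ->
  smooth_on D g -> smooth_on D f.
Proof.
move=> oD fg sg.
have near_D (h k : V -> W) x : D x -> {in D, h =1 k} -> {near x, h =1 k}.
  move=> Dx hk; have := open_nbhs_nbhs (conj oD Dx).
  by apply: filterS => y Dy; apply/hk/mem_set.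
have E vs : {in D, iter_derive f vs =1 iter_derive g vs}.
  elim: vs => [//|v vs IH] x /set_mem Dx /=.
  exact/near_eq_derive/near_D.
move=> vs x Dx; apply: near_eq_differentiable (sg vs x Dx).
exact: near_D.
Qed.

Lemma smooth_on_linear D (f : {linear V -> W}) : continuous f -> smooth_on D f.
Proof.
move=> cf vs x _.
have df y : differentiable f y by exact: linear_differentiable.
(* An iterated derivative of [f] is [f] itself at order 0, the constant [f v] at order 1, and zero
   afterwards. *)
have dE (h : V -> W) : h = f \/ (exists c : W, h = cst c) -> differentiable h x.
  by move=> [->//|[c ->]]; exact: differentiable_cst.
apply: dE.
elim: vs => [|v vs [E|[c E]]]; first by left.
  by right; exists (f v); apply/funext => y /=; rewrite E deriveE// diff_lin.
by right; exists 0; apply/funext => y /=; rewrite E derive_cst.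
Qed.

End smoothness.

(** * Local structure of the sorting map *)

Section sorting_topology.
Context {R : realType} {m : nat}.
Implicit Types (u v : 'rV[R]_m) (s : 'S_m) (D : set 'rV[R]_m).

Lemma col_perm_continuous s : continuous (@col_perm R 1 m s).
Proof.
(* A neighbourhood of a matrix contains a box [P] of entrywise neighbourhoods; relabelling its sides
   by [s^-1] gives a box around [u]. *)
move=> u A [P uP PA]; exists (fun i j => P i (s^-1%g j)).
  by move=> i j; have := uP i (s^-1%g j); rewrite mxE permKV.
move=> v vP; apply: PA => i j; rewrite mxE.
by have := vP i (s j); rewrite permK.
Qed.

Lemma open_weyl_chamber : open (@weyl_chamber R m).
Proof.
rewrite openE => u wu.
have near_lt (i j : 'I_m) :
    nbhs u [set v : 'rV[R]_m | (i < j)%N -> v 0 i < v 0 j].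
  have [ij|ji] := ltnP i j; last exact: filterE.
  have uij : 0 < u 0 j - u 0 i by rewrite subr_gt0; apply: wu.
  have c : (v : 'rV[R]_m) 0 j - v 0 i @[v --> u] --> u 0 j - u 0 i.
    apply: cvgB; first exact: nbhs_filter.
      exact: (@coord_continuous R 1 m 0 j u).
    exact: (@coord_continuous R 1 m 0 i u).
  apply: (@filterS _ (nbhs u) _ _ _ _ (cvgr_gt _ c _ uij)) => v /=.
  by rewrite subr_gt0.
exact: (filter_forall _ (fun i => filter_forall _ (near_lt i))).
Qed.

Lemma sorted_up_near u : distinct_vectors u ->
  exists s, \forall v \near u, sorted_up v = col_perm s v.
Proof.
move=> du; have [s sE] := sorted_upE u; exists s.
have wu : weyl_chamber (col_perm s u) by rewrite -sE; apply: sorted_up_in_weyl.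
have wn := open_nbhs_nbhs (conj open_weyl_chamber wu).
apply: (@filterS _ (nbhs u) _ _ _ _ (@col_perm_continuous s u _ wn)) => v wv.
by rewrite -(sorted_up_col_perm v s) sorted_up_weyl.
Qed.

Lemma sorted_up_continuous_at u :
  distinct_vectors u -> {for u, continuous sorted_up}.
Proof.
move=> /sorted_up_near[s sE] A; rewrite (nbhs_singleton sE) => uA.
have sA := @col_perm_continuous s u A uA.
by apply: (@filterS2 _ (nbhs u) _ _ _ _ _ sE sA) => v /= ->.
Qed.

Lemma open_distinct_vectors : open (@distinct_vectors R m).
Proof.
rewrite openE => u du; rewrite /interior.
have wu := sorted_up_in_weyl du.
have wn := open_nbhs_nbhs (conj open_weyl_chamber wu).
apply: (@filterS _ (nbhs u) _ _ _ _ (sorted_up_continuous_at du wn)) => v.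
move=> /weyl_distinct.
have [s ->] := sorted_upE v.
move=> /(@col_perm_distinct _ _ _ s^-1%g).
by rewrite -col_permM mulVg col_perm1.
Qed.

(** The local inverse [col_perm s^-1] carries points near [sorted_up u] to vectors of [D] that [s]
    sorts, so all these points are attained. *)
Lemma open_image_sorted_up D :
  open D -> D `<=` distinct_vectors -> open (sorted_up @` D).
Proof.
move=> oD Dd; rewrite openE => _ [u Du <-]; rewrite /interior.
have [s sE] := sorted_up_near (Dd u Du).
have uE : col_perm s^-1%g (sorted_up u) = u.
  by rewrite (nbhs_singleton sE) -col_permM mulVg col_perm1.
have : nbhs u (D `&` [set v | sorted_up v = col_perm s v]).
  by apply: (@filterI _ (nbhs u)) => //; apply: open_nbhs_nbhs.
rewrite -{1}uE => /(@col_perm_continuous s^-1%g _) un.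
apply: (@filterS _ (nbhs (sorted_up u)) _ _ _ _ un) => z [Dz zE].
exists (col_perm s^-1%g z) => //.
by rewrite zE -col_permM mulgV col_perm1.
Qed.

Lemma sorted_up_local_diffeo u :
  distinct_vectors u -> local_diffeo_at sorted_up u.
Proof.
move=> du; have [s sE] := sorted_up_near du.
(* The interior makes the domain open; intersecting with the distinct vectors lets
   [open_image_sorted_up] apply. *)
pose N :=
  [set v : 'rV[R]_m | sorted_up v = col_perm s v]° `&` distinct_vectors.
have oN : open N.
  by apply: openI; [exact: open_interior|exact: open_distinct_vectors].
have NE v : N v -> sorted_up v = col_perm s v by case=> /nbhs_singleton.
exists N, (col_perm s^-1%g); split.
- by split.
- by apply: open_image_sorted_up => // v [].
- apply: (smooth_on_eq oN (g := col_perm s)) => [v /set_mem/NE//|].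
  exact: (smooth_on_linear (f := [the {linear _ -> _} of col_perm s])
    (@col_perm_continuous s)).
- exact: (smooth_on_linear (f := [the {linear _ -> _} of col_perm s^-1%g])
    (@col_perm_continuous s^-1%g)).
- by move=> v /NE ->; rewrite -col_permM mulVg col_perm1.
Qed.

End sorting_topology.

(** * The sorted chart on the orbit space *)

Section orbit_chart.
Context {R : realType} {m : nat}.
Implicit Types (u v : config R m) (s : 'S_m) (o : orbit_space R m).
Implicit Types (D : set 'rV[R]_m).

Lemma config_distinct u : distinct_vectors (set_val u).
Proof. exact: set_valP. Qed.

Lemma orbit_projP u v :
  orbit_proj u = orbit_proj v <->
  exists s, set_val v = col_perm s (set_val u).
Proof.
split=> [/eqquotP/existsP[s /eqP]|[s vE]]; first by exists s.
by apply/eqquotP/existsP; exists s; apply/eqP.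
Qed.

Lemma sort_orbit_proj u : sort_orbit (orbit_proj u) = sorted_up (set_val u).
Proof.
have /orbit_projP[s ->] :
    orbit_proj (generic_quotient.repr (orbit_proj u)) = orbit_proj u.
  exact: reprK.
by rewrite sorted_up_col_perm.
Qed.

(** By the universal property of the quotient topology, continuity is checked on [config], where the
    map is sorting. *)
Lemma sort_orbit_continuous : continuous (@sort_orbit R m).
Proof.
apply/quotient_continuous.
have -> : @sort_orbit R m \o \pi_(orbit_space R m)%qT =
    (fun u : config R m => sorted_up (set_val u)).
  by apply/funext => u; exact: sort_orbit_proj.
move=> u A /(sorted_up_continuous_at (@config_distinct u)).
exact: (@initial_continuous _ _ (@set_val _ (@distinct_vectors R m)) u).
Qed.

Lemma open_orbit_proj D : open D ->
  open (orbit_proj @` [set u : config R m | D (set_val u)]).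
Proof.
(* Openness in the quotient is openness of the saturation, which is the trace on [config] of this
   union of permuted copies of [D]. *)
move=> oD; exists (\bigcup_s (col_perm s @^-1` D)).
  by apply: bigcup_open => s _; apply: open_comp => // u _;
    exact: col_perm_continuous.
apply/seteqP; split => u /=.
  move=> [s _ /= Du].
  have dsu := col_perm_distinct (s := s) (@config_distinct u).
  exists (SigSub (mem_set dsu)) => //.
  apply/orbit_projP; exists (s^-1%g).
  change (set_val u = col_perm s^-1%g (col_perm s (set_val u))).
  by rewrite -col_permM mulVg col_perm1.
move=> [v Dv /orbit_projP[s uE]]; exists s^-1%g => //=.
by rewrite uE -col_permM mulVg col_perm1.
Qed.

(** The inverse chart sends [z] to the orbit of [z] itself; [u0] supplies its value where [z] has
    repeated entries. *)
Lemma sort_orbit_topological_chart D (u0 : config R m) :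
  open D -> D `<=` distinct_vectors ->
  topological_chart (orbit_proj @` [set u : config R m | D (set_val u)])
    sort_orbit.
Proof.
move=> oD Dd; split.
- exact: open_orbit_proj.
- rewrite (_ : _ @` _ = sorted_up @` D); first exact: open_image_sorted_up.
  apply/seteqP; split => [_ [_ [u Du <-] <-]|_ [u Du <-]].
    by exists (set_val u) => //; rewrite sort_orbit_proj.
  exists (orbit_proj (SigSub (mem_set (Dd u Du)) : config R m)).
    by exists (SigSub (mem_set (Dd u Du))).
  by rewrite sort_orbit_proj.
- by move=> o _; exact: sort_orbit_continuous.
pose inj z : config R m :=
  if pselect (distinct_vectors z) is left dz then SigSub (mem_set dz) else u0.
have injE z : distinct_vectors z -> set_val (inj z) = z.
  by rewrite /inj; case: pselect.
exists (orbit_proj \o inj); split.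
  move=> _ [u Du <-]; rewrite /= sort_orbit_proj; apply/orbit_projP.
  have [s sE] := sorted_upE (set_val u); exists s^-1%g.
  rewrite injE; last exact/weyl_distinct/sorted_up_in_weyl/config_distinct.
  by rewrite sE -col_permM mulVg col_perm1.
move=> _ [_ [u Du <-] <-]; rewrite sort_orbit_proj.
set z := sorted_up _.
have dz : distinct_vectors z.
  exact/weyl_distinct/sorted_up_in_weyl/config_distinct.
move=> A /(@pi_continuous _ _ (inj z))[B [[W oW <-] /= Wz WA]].
rewrite injE// in Wz.
have nW := open_nbhs_nbhs (conj oW Wz).
have nd := open_nbhs_nbhs (conj open_distinct_vectors dz).
apply: (@filterS2 _ (nbhs z) _ _ _ _ _ nW nd) => v Wv dv.
by apply: WA; rewrite /= injE.
Qed.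

End orbit_chart.

(** * Translation invariance of Lebesgue integrals *)

Section translation_invariance.
Context {R : realType}.
Local Open Scope ereal_scope.
Import HBNNSimple.

Let mR := measurableTypeR R.

Lemma measurable_translation (c : R) :
  measurable_fun [set: mR] ((fun t => t + c)%R : mR -> mR).
Proof.
apply: continuous_measurable_fun => t.
by apply: cvgD; [exact: cvg_id|exact: cvg_cst].
Qed.

(** The pushforward under translation gives each interval []a, b]] its length, which characterizes
    Lebesgue measure. *)
Lemma lebesgue_measure_translation (c : R) (A : set R) : measurable A ->
  lebesgue_measure [set t | A (t + c)%R] = lebesgue_measure A.
Proof.
move=> mA; apply/esym.
pose f : {mfun mR >-> mR} := HB.pack (fun t : mR => t + c)%R
  (isMeasurableFun.Build _ _ _ _ _ (measurable_translation c)).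
rewrite (@lebesgue_measure_unique R (pushforward lebesgue_measure f))//.
move=> _ [[a b]] _ <-.
transitivity (lebesgue_measure `](a - c)%R, (b - c)%R]%classic); last first.
  congr lebesgue_measure; apply/seteqP.
  by split=> t /=; rewrite !in_itv/= ltrBlDr lerBrDr.
rewrite !lebesgue_measure_itv/= !lte_fin ltrD2r.
by case: ifP => // _; rewrite -!EFinB opprB addrA subrK.
Qed.

Lemma sintegral_translation (c : R) (h : {nnsfun mR >-> R}) :
  sintegral lebesgue_measure (fun t => h (t + c)%R) =
  sintegral lebesgue_measure h.
Proof.
apply: eq_fsbigr => r _; congr (_ * _).
have mh : measurable (h @^-1` [set r]) by exact: measurable_funPTI.
exact: (lebesgue_measure_translation c mh).
Qed.

Let nnsfun_translation (c : R) (h : {nnsfun mR >-> R}) :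
  exists k : {nnsfun mR >-> R}, k = (fun t => h (t + c)%R) :> (mR -> R).
Proof.
pose g : mR -> R := fun t => h (t + c)%R.
have mg : measurable_fun setT g.
  exact: (measurableT_comp (@measurable_funP _ _ _ _ setT h)
    (measurable_translation c)).
have fg : finite_set (range g).
  by apply: (sub_finite_set _ (fimfunP h)) => _ [t _ <-]; exists (t + c)%R.
have pg x : (0 <= g x)%R by exact: fun_ge0.
pose k : {nnsfun mR >-> R} := HB.pack g (isMeasurableFun.Build _ _ _ _ _ mg)
  (FiniteImage.Build _ _ _ fg) (isNonNegFun.Build _ _ _ pg).
by exists k.
Qed.

(* The integral is defined as a supremum over the simple functions below [f],
   so no measurability of [f] is needed. *)
Lemma integral_translation (c : R) (f : R -> \bar R) :
  \int[@lebesgue_measure R]_t f (t + c)%R = \int[@lebesgue_measure R]_t f t.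
Proof.
(* One inequality, for all shifts and nonnegative functions, suffices: the shift by [- c] of the
   translated function gives the converse, and positive and negative parts are treated
   separately. *)
suff le d (g : R -> \bar R) : (forall t, 0 <= g t) ->
    \int[@lebesgue_measure R]_t g t <= \int[@lebesgue_measure R]_t g (t + d)%R.
  have eq (g : R -> \bar R) : (forall t, 0 <= g t) ->
      \int[@lebesgue_measure R]_t g (t + c)%R = \int[@lebesgue_measure R]_t g t.
    move=> g0; apply/le_anti/andP; split; last exact: le.
    apply: le_trans (le (- c)%R _ _) _ => //.
    by under eq_integral do rewrite subrK.
  rewrite integralE [RHS]integralE -(eq _ (funepos_ge0 f)).
  rewrite -(eq _ (funeneg_ge0 f)); congr (_ - _).
    by apply: eq_integral => t _; rewrite !funeposE.
  by apply: eq_integral => t _; rewrite !funenegE.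
move=> g0; rewrite !ge0_integralTE//; apply: ge_ereal_sup => _ [h /= hg <-].
have [k kE] := nnsfun_translation d h.
apply: ereal_sup_ubound; exists k => /=.
  by move=> t; rewrite kE.
by rewrite kE sintegral_translation.
Qed.

Definition tuple_translation n (c y : n.-tuple R) : n.-tuple R :=
  [tuple (tnth y i + tnth c i)%R | i < n].

(** By induction on [n]: one-dimensional invariance shifts the outer variable by the head of [c],
    and the induction hypothesis shifts the others by its tail. *)
Lemma integral_tuple_translation n (c : n.-tuple R) (f : n.-tuple R -> \bar R) :
  integral_tuple (f \o tuple_translation c) = integral_tuple f.
Proof.
elim: n c f => [|n IH] c f /=; first by congr f; rewrite !tuple0.
rewrite -[RHS](integral_translation (thead c)).
apply: eq_integral => t _.
rewrite -[RHS](IH [tuple of behead c]); congr integral_tuple.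
apply/funext => y; congr f; apply/val_inj => /=.
rewrite enum_ordSl /= tnth0 -map_comp; congr (_ :: _).
apply: eq_map => i /=.
by rewrite tnthS [X in tnth X (lift _ _)](tuple_eta c) tnthS.
Qed.

End translation_invariance.

(** * The Gaussian law of a release *)

Section releases.
Context {R : realType}.

Lemma measurable_tuple_translation n (c : n.-tuple R) :
  measurable_fun [set: n.-tuple R] (tuple_translation c).
Proof.
apply/measurable_fun_tnthP => i.
rewrite (_ : _ \o _ =
    (fun t : measurableTypeR R => t + tnth c i) \o (@tnth n R ^~ i)).
  apply: measurableT_comp; first exact: measurable_translation.
  exact: measurable_tnth.
by apply/funext => y /=; rewrite tnth_mktuple.
Qed.

Lemma gaussian_pdf_translation n (c : n.-tuple R) (S : 'M[R]_n) y :
  gaussian_pdf (\row_i tnth c i) S (tuple_translation c y) = gaussian_pdf 0 S y.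
Proof.
rewrite /gaussian_pdf.
suff -> : \row_i tnth (tuple_translation c y) i - \row_i tnth c i =
  \row_i tnth y i - 0 by [].
by apply/rowP => i; rewrite !mxE tnth_mktuple addrK subr0.
Qed.

(** A change of variables in the integral of density times indicator; the density depends only on
    the point minus the mean. *)
Lemma is_gaussian_translation n (c : n.-tuple R) (S : 'M[R]_n)
    (law : set (n.-tuple R) -> \bar R) :
  is_gaussian law 0 S ->
  is_gaussian (fun A => law (tuple_translation c @^-1` A)) (\row_i tnth c i) S.
Proof.
move=> lawG A mA; rewrite lawG; last first.
  by rewrite -[X in measurable X]setTI; apply: measurable_tuple_translation.
rewrite -[RHS](integral_tuple_translation c); congr integral_tuple.
by apply/funext => y; rewrite /= gaussian_pdf_translation !indicE.
Qed.

Lemma release_is_gaussian m L (q : 'I_L -> 'rV[R]_m -> R) (S : 'M[R]_L)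
    (d : measure_display) (Omega : measurableType d) (P : probability Omega R)
    (w : {RV P >-> L.-tuple R}) x :
  is_gaussian (distribution P w) 0 S ->
  is_gaussian (pushforward P (release q w x)) (\row_l q l x) S.
Proof.
pose c := [tuple q l x | l < L].
move=> /(@is_gaussian_translation _ c S).
have -> : \row_l tnth c l = \row_l q l x.
  by apply/rowP => l; rewrite !mxE tnth_mktuple.
suff -> : release q w x = tuple_translation c \o w by [].
apply/funext => t; apply: eq_from_tnth => l.
by rewrite !tnth_mktuple addrC.
Qed.

End releases.

Theorem proposition4 (R : realType) (m L : nat)
    (xC : 'rV[R]_m) (xC_distinct : distinct_vectors xC)
    (q : 'I_L -> 'rV[R]_m -> R)
    (q_inv : forall l, permutation_invariant (q l))
    (Sigma : 'M[R]_L) (Sigma_pd : positive_definite Sigma)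
    (d : measure_display) (Omega : measurableType d)
    (P : probability Omega R) (w : {RV P >-> L.-tuple R})
    (w_gaussian : is_gaussian (distribution P w) 0 Sigma)
    (U : set 'rV[R]_m) (U_nbhs : nbhs xC U)
    (U_collision : forall a b : 'I_m, a != b ->
       U `&` collision_hyperplane a b = set0) :
  let law x := pushforward P (release q w x) in
  let p y x := release_density q Sigma y x in
  [/\ (* (i) *)
      forall x, U x ->
        [/\ has_density (law x) (p ^~ x),
            forall pi : 'S_m, same_law (law x) (law (col_perm pi x)),
            forall (pi : 'S_m) y, p y x = p y (col_perm pi x) &
            (1 < m)%N -> ~ globally_identifiable_at law x],
      (* (ii) *)
      [/\ forall u : config R m, U (set_val u) ->
            sort_orbit (orbit_proj u) = sorted_up (set_val u),
          topological_chart
            (orbit_proj @` [set u : config R m | U° (set_val u)]) sort_orbit,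
          forall u, U° u -> local_diffeo_at sorted_up u &
          forall u, U u -> weyl_chamber (sorted_up u)] &
      (* (iii) *)
      forall x xhat, U x -> U xhat ->
        matching_loss xhat x = sqnorm2 (sorted_up xhat - sorted_up x)].
Proof.
move=> law p.
have U_distinct : U `<=` distinct_vectors.
  move=> u Uu a b uab; apply/eqP; apply: contraT => ab.
  by have : set0 u by rewrite -(U_collision a b ab).
(* Invariance of the queries makes the two releases equal at every outcome, hence also in law. *)
have law_perm x s : law (col_perm s x) = law x.
  rewrite /law; congr pushforward; apply/funext => t.
  by apply: eq_from_tnth => l; rewrite !tnth_mktuple -q_inv.
split.
- move=> x Ux; split.
  + exact: (release_is_gaussian q x w_gaussian).
  + by move=> s A _; exact: (congr1 (@^~ A) (esym (law_perm x s))).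
  + move=> s y; have qE : \row_l q l x = \row_l q l (col_perm s x).
      by apply/rowP => l; rewrite !mxE -q_inv.
    exact: (congr1 (fun mu => gaussian_pdf mu Sigma y) qE).
  (* Some permutation moves [x], whose entries are distinct, while the law stays the same;
     identifiability would forbid this. *)
  + move=> m1 idx; have [s /eqP] := col_perm_nontrivial m1 (U_distinct x Ux).
    by apply; apply: idx => A _; exact: (congr1 (@^~ A) (law_perm x s)).
- split.
  + by move=> u _; exact: sort_orbit_proj.
  + apply: sort_orbit_topological_chart; last 2 first.
    * exact: open_interior.
    * by move=> u /nbhs_singleton /U_distinct.
    * exact: (SigSub (mem_set xC_distinct)).
  + by move=> u /nbhs_singleton /U_distinct; exact: sorted_up_local_diffeo.
  + by move=> u /U_distinct; exact: sorted_up_in_weyl.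
- by move=> x xhat _ _; exact: matching_loss_sorted.
Qed.
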